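(* Let $G$ be a cyclic group of order $p_{1}^{\alpha_{1}} \cdots p_{k}^{\alpha_{k}}$ where $p_{1},\ldots,p_{k}$ are distinct odd primes, and $\alpha_{i} \geq 1$ for all $i \in \{1,\ldots,k\}$. Then $G$ has at least $\prod_{i=1}^{k} \left(p_{i}^{2\alpha_{i}}-2p_{i}^{2\alpha_{i}-1}\right)$ antiautomorphisms.
   Context: Let $G$ be an abelian group (written additively). A function $f: G \rightarrow G$ (not necessarily a homomorphism) is an antimorphism if the map $\mathrm{id}_{G}-f$, $x \mapsto x-f(x)$, is injective. An antiautomorphism of $G$ is an antimorphism $f: G\to G$ that is a bijection. *)

(* Defs.v *)
From mathcomp Require Import all_boot all_order all_algebra all_fingroup all_solvable.
From mathcomp Require Import boolp.

Set Implicit Arguments.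
Unset Strict Implicit.
Unset Printing Implicit Defensive.

Import GRing.Theory.
Local Open Scope ring_scope.

Definition antimorphism (G : zmodType) (f : G -> G) : Prop :=
  injective (fun x => x - f x).

Definition antiautomorphism (G : zmodType) (f : G -> G) : Prop :=
  antimorphism f /\ bijective f.

(* On a finite group every function G -> G is represented by exactly one
   element of {ffun G -> G}, so this is the set of all antiautomorphisms. *)
Definition antiautomorphisms (G : finZmodType) : {set {ffun G -> G}} :=
  [set f : {ffun G -> G} | `[< antiautomorphism f >]].

(* Main.v *)
Require Import Defs.
From mathcomp Require Import all_boot all_order all_algebra all_fingroup all_solvable.
From mathcomp Require Import boolp.

(** For a cyclic group [G] of order [n], each map [x |-> b - a x] with
    [a] and [a + 1] both prime to [n] is an antiautomorphism: it is injective
    because multiplication by [a] is, and [x - (b - a x) = (a + 1) x - b] is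
    injective because multiplication by [a + 1] is.  Distinct pairs [(a, b)]
    with [0 <= a < n] give distinct maps, since [b] is the value at [0] and [a]
    is then read off at a generator.  So [G] has at least [n] times as many
    antiautomorphisms as there are such [a] ([card_affine]).

    These [a] are counted from below prime by prime: the Chinese remainder
    theorem makes the count supermultiplicative on coprime arguments
    ([card_succ_units_coprime]), and for [n = p ^ e.+1] every [a] with residue
    other than [0] and [-1] modulo [p] qualifies, which gives
    [p ^ e * (p - 2)] of them ([card_succ_units_pfactor]).  Multiplying by
    [p ^ e.+1] gives the factor [p ^ (2 * e.+1) - 2 * p ^ (2 * e.+1 - 1)]. *)

Import GRing.Theory FinRing.Theory.

Definition succ_units n : {set 'I_n} :=
  [set a : 'I_n | coprime n a && coprime n a.+1].

(** The residue of a Chinese remainder inherits the condition on [a] from its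
    two components, and determines them. *)
Lemma card_succ_units_coprime m n : coprime m n ->
  #|succ_units m| * #|succ_units n| <= #|succ_units (m * n)|.
Proof.
move=> co_mn.
case: (posnP m) => [->|m_gt0].
  by rewrite (leq_trans (leq_mul (max_card _) (leqnn _))) // card_ord.
case: (posnP n) => [->|n_gt0].
  by rewrite (leq_trans (leq_mul (leqnn _) (max_card _))) // card_ord muln0.
have mn_gt0 : 0 < m * n by rewrite muln_gt0 m_gt0.
pose crt (u : 'I_m * 'I_n) : 'I_(m * n) :=
  Ordinal (ltn_pmod (chinese m n u.1 u.2) mn_gt0).
have crt1 u : crt u = u.1 %[mod m].
  by rewrite /= modn_dvdm ?dvdn_mulr // chinese_modl.
have crt2 u : crt u = u.2 %[mod n].
  by rewrite /= modn_dvdm ?dvdn_mull // chinese_modr.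
have crt_inj : injective crt.
  move=> u v eq_uv; move: (crt1 u) (crt2 u); rewrite eq_uv crt1 crt2.
  rewrite !modn_small //; case: u v {eq_uv} => [u1 u2] [v1 v2] /= e1 e2.
  by congr pair; apply: val_inj.
rewrite -cardsX -(card_imset _ crt_inj); apply/subset_leq_card/subsetP => c.
case/imsetP=> u; rewrite !inE => /andP[/andP[um um1] /andP[un un1]] ->.
have coS d a b : a = b %[mod d] -> coprime d a.+1 = coprime d b.+1.
  move=> eq_ab; rewrite -(coprime_modr d a.+1) -(coprime_modr d b.+1).
  by rewrite -addn1 -modnDml eq_ab modnDml addn1.
have co d a b : a = b %[mod d] -> coprime d a = coprime d b.
  by move=> eq_ab; rewrite -coprime_modr eq_ab coprime_modr.
rewrite !coprimeMl (co _ _ _ (crt1 u)) (co _ _ _ (crt2 u)).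
by rewrite (coS _ _ _ (crt1 u)) (coS _ _ _ (crt2 u)) um um1 un un1.
Qed.

Lemma card_succ_units_prod (I : finType) (q : I -> nat) :
    {in predT &, forall i j, i != j -> coprime (q i) (q j)} ->
  \prod_i #|succ_units (q i)| <= #|succ_units (\prod_i q i)|.
Proof.
move=> co_q; have := index_enum_uniq I.
elim: (index_enum I) => [_|i s IHs /= /andP[s'i /IHs{}IHs]].
  rewrite !big_nil card_gt0; apply/set0Pn; exists ord0.
  by rewrite inE !coprime1n.
rewrite !big_cons; apply: leq_trans (card_succ_units_coprime _ _ _).
  by rewrite leq_mul2l IHs orbT.
rewrite big_seq; apply: (big_ind (coprime (q i))) => [|x y|j s_j].
- exact: coprimen1.
- by rewrite coprimeMr => -> ->.
by apply: co_q => //; apply: contraNneq s'i => ->.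
Qed.

Lemma card_succ_units_pfactor p e : prime p ->
  p ^ e * (p - 2) <= #|succ_units (p ^ e.+1)|.
Proof.
move=> p_pr; have p_gt0 := prime_gt0 p_pr.
(* The shift by one skips the residue 0; r < p - 2 then avoids p - 1. *)
have small (r : 'I_(p - 2)) : r.+2 < p by rewrite -[r.+2]/(2 + r) -ltn_subRL.
have lt_digits (u : 'I_(p ^ e) * 'I_(p - 2)) : u.1 * p + u.2.+1 < p ^ e.+1.
  rewrite expnSr (@leq_trans (u.1.+1 * p)) //.
    by rewrite mulSn addnC ltn_add2r ltnW.
  by rewrite leq_mul2r ltn_ord orbT.
pose digits u : 'I_(p ^ e.+1) := Ordinal (lt_digits u).
have digits_inj : injective digits.
  move=> [q r] [q' r'] /(congr1 val) /= eq_qr.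
  have lt_r := ltnW (small r); have lt_r' := ltnW (small r').
  have eq_q : q = q'.
    apply: val_inj; move/(congr1 (divn^~ p)): eq_qr.
    by rewrite !divnMDl // !divn_small // !addn0.
  by congr pair => //; apply: val_inj; move: eq_qr; rewrite eq_q => /addnI[].
rewrite -[p ^ e]card_ord -[p - 2]card_ord -card_prod -(card_codom digits_inj).
apply/subset_leq_card/subsetP => _ /codomP[u ->].
rewrite inE; apply/andP; split; rewrite coprimeXl // prime_coprime //=.
  by rewrite dvdn_addr ?dvdn_mull // gtnNdvd // ltnW.
by rewrite -addnS dvdn_addr ?dvdn_mull // gtnNdvd.
Qed.

Lemma mulrn_coprime_inj (G : finZmodType) a :
  coprime #|G| a -> injective (fun x : G => (x *+ a)%R).
Proof.
rewrite -cardsT => co_a x y eq_xy.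
have cancel_a := expgK (G := [set: G]%G) co_a.
by rewrite -[x]cancel_a ?inE // -[y in RHS]cancel_a ?inE // !zmodXgE eq_xy.
Qed.

Lemma affine_antiautomorphism (G : finZmodType) a (b : G) :
    coprime #|G| a -> coprime #|G| a.+1 ->
  antiautomorphism (fun x : G => b - x *+ a)%R.
Proof.
move=> co_a co_a1; split.
  move=> x y; rewrite !opprB !addrA -!mulrS => /addIr.
  exact: mulrn_coprime_inj _ _ co_a1 x y.
by apply: injF_bij => x y /addrI/oppr_inj; apply: mulrn_coprime_inj.
Qed.

(** Cyclicity is what makes the parametrisation by [(b, a)] injective: a
    generator has order [#|G|], so it tells the multipliers apart. *)
Lemma card_affine (G : finZmodType) : cyclic [set: G] ->
  #|G| * #|succ_units #|G| | <= #|antiautomorphisms G|.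
Proof.
case/cyclicP=> g defG; have og : #[g]%g = #|G| by rewrite orderE -defG cardsT.
pose affine (u : G * 'I_#|G|) : {ffun G -> G} := [ffun x => u.1 - x *+ u.2]%R.
have affine_inj : injective affine.
  move=> [b a] [b' a'] /ffunP eq_f.
  have eq_b : b = b' by have := eq_f 0%R; rewrite !ffunE !mul0rn !subr0.
  have := eq_f g; rewrite !ffunE eq_b => /addrI/oppr_inj/eqP.
  rewrite /= -!zmodXgE eq_expg_mod_order og !modn_small // => /eqP eq_a.
  by congr pair; apply: val_inj.
rewrite -[X in X * _]cardsT -cardsX -(card_imset _ affine_inj).
apply/subset_leq_card/subsetP => _ /imsetP[[b a] + ->].
rewrite !inE /= => /andP[co_a co_a1]; apply/asboolP.
have -> : fun_of_fin (affine (b, a)) = (fun x => b - x *+ a)%R.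
  by apply/funext => x; rewrite ffunE.
exact: affine_antiautomorphism.
Qed.

Theorem proposition2p5 (G : finZmodType) (k : nat) (p alpha : 'I_k -> nat)
    (p_prime : forall i, prime (p i)) (p_odd : forall i, odd (p i))
    (p_distinct : injective p) (alpha_ge1 : forall i, 1 <= alpha i)
    (G_cyclic : cyclic [set: G])
    (G_order : #|G| = \prod_(i < k) p i ^ alpha i) :
  \prod_(i < k) (p i ^ (2 * alpha i) - 2 * p i ^ (2 * alpha i - 1))
    <= #|antiautomorphisms G|.
Proof.
apply: leq_trans (card_affine _ G_cyclic); rewrite G_order.
have co_p : {in predT &, forall i j, i != j ->
    coprime (p i ^ alpha i) (p j ^ alpha j)}.
  move=> i j _ _ neq_ij; apply/coprimeXl/coprimeXr.
  by rewrite prime_coprime // dvdn_prime2 // (inj_eq p_distinct).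
apply: leq_trans (leq_mul (leqnn _) (card_succ_units_prod _ _ co_p)).
rewrite -big_split /=; apply: leq_prod => i _.
have := alpha_ge1 i; case: (alpha i) => // e _.
apply: leq_trans (leq_mul (leqnn _) (card_succ_units_pfactor _ e (p_prime i))).
have -> : 2 * e.+1 = (e.+1 + e).+1 by rewrite mul2n -addnn addnS.
by rewrite subn1 mulnA -expnD mulnBr -expnSr [_ * 2]mulnC.
Qed.
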